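(* Let $k$ be a field of characteristic zero and let $A$ and $B$ be $A_\infty$-algebras over $k$. Let $(E,\mathcal{D})$, $\mathcal{D}=\{\mathcal{D}_n\}_{n\ge1}$, be an $A_\infty$-extension of $B$ by $A$, with $E$ identified with $A\oplus B$ as a graded vector space through a linear splitting of $0\to A\to E\to B\to0$. Then $\mathcal{D}\circ\Xi$ defines an OCHA structure on the pair $(B,A)$ (that is, $\mathcal{H}_c=B$, $\mathcal{H}_o=A$); explicitly, with $\pi_A,\pi_B$ the projections of $E=A\oplus B$, the maps $$l_n=\pi_B\circ\mathcal{D}_n\circ\Xi|_{B^{\wedge n}}:B^{\wedge n}\to B,\qquad n_{p,q}=\pi_A\circ\mathcal{D}_{p+q}\circ\Xi|_{B^{\wedge p}\otimes A^{\otimes q}}:B^{\wedge p}\otimes A^{\otimes q}\to A$$ form an OCHA. The $L_\infty$-structure $\{l_n\}$ on $B$ is the Lada-Markl symmetrization of the $A_\infty$-structure on $B$.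
   Context: All vector spaces are $\mathbb{Z}$-graded over $k$. Koszul convention: $(f \otimes g)(x \otimes y) = (-1)^{|g||x|} f(x)\otimes g(y)$. In exponents of $-1$ an element stands for its degree. For $\sigma \in S_n$, $(-1)^{\epsilon(\sigma)}$ is the Koszul sign of $x_1\otimes\cdots\otimes x_n \mapsto (-1)^{\epsilon(\sigma)}x_{\sigma(1)}\otimes\cdots\otimes x_{\sigma(n)}$. $\mathfrak{S}_{a,b}$ is the set of $(a,b)$-unshuffles: $\sigma\in S_{a+b}$ with $\sigma(1)<\cdots<\sigma(a)$ and $\sigma(a+1)<\cdots<\sigma(a+b)$. $A_\infty$-algebra: a graded vector space $V$ with degree one maps $m_n:V^{\otimes n}\to V$ ($n\ge1$) such that for all $n\geq 1$, $\sum_{i+s+j=n,\,s\ge1}m_{i+1+j}(1^{\otimes i}\otimes m_s\otimes1^{\otimes j})=0$ (equivalently, the coderivation of the tensor coalgebra $T^cV$ lifting $\{m_n\}$ squares to zero). A linear $A_\infty$-morphism $(V,\{m_n\})\to(W,\{m'_n\})$ is a degree zero linear map $f:V\to W$ with $f\circ m_n=m'_n\circ f^{\otimes n}$ for all $n\ge1$. An $A_\infty$-extension of $B$ by $A$ is an $A_\infty$-algebra $E$ with a short exact sequence $0\to A\to E\to B\to0$ in which every map is a linear $A_\infty$-morphism. Lada-Markl symmetrization of an $A_\infty$-structure $\{m_n\}$ on $B$: $l_n(b_1,\dots,b_n)=\sum_{\sigma\in S_n}(-1)^{\epsilon(\sigma)}m_n(b_{\sigma(1)},\dots,b_{\sigma(n)})$.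 Shuffle product: $Sh(a_1\otimes\cdots\otimes a_i\,|\,a_{i+1}\otimes\cdots\otimes a_n)=\sum_\sigma(-1)^{\epsilon(\sigma)}a_{\sigma(1)}\otimes\cdots\otimes a_{\sigma(n)}$, summed over $\sigma\in S_n$ with $\sigma^{-1}(1)<\cdots<\sigma^{-1}(i)$ and $\sigma^{-1}(i+1)<\cdots<\sigma^{-1}(n)$. Symmetrization: $\chi(c_1\wedge\cdots\wedge c_n)=\sum_{\sigma\in S_n}(-1)^{\epsilon(\sigma)}c_{\sigma(1)}\otimes\cdots\otimes c_{\sigma(n)}$. For graded vector spaces $\mathcal{H}_c,\mathcal{H}_o$, with $\Lambda^c$ the graded symmetric coalgebra and $T^c$ the tensor coalgebra, $\Xi:\Lambda^c\mathcal{H}_c\otimes T^c\mathcal{H}_o\to T^c(\mathcal{H}_c\oplus\mathcal{H}_o)$ is $$\Xi((c_1\wedge\cdots\wedge c_p)\otimes(o_1\otimes\cdots\otimes o_q))=Sh(\chi(c_1\wedge\cdots\wedge c_p)\,|\,o_1\otimes\cdots\otimes o_q).$$ $L_\infty$-algebra: a graded vector space $V$ with degree one graded symmetric maps $l_n:V^{\otimes n}\to V$ ($n\ge1$) such that for all $n\ge1$ $$\sum_{k+l=n,\,k\ge1,\,l\geq 0}\ \sum_{\sigma\in\mathfrak{S}_{k,l}}(-1)^{\epsilon(\sigma)}\,l_{l+1}(l_k(v_{\sigma(1)},\dots,v_{\sigma(k)}),v_{\sigma(k+1)},\dots,v_{\sigma(n)})=0.$$ OCHA structure on $(\mathcal{H}_c,\mathcal{H}_o)$: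 degree one maps $l_n:\mathcal{H}_c^{\wedge n}\to\mathcal{H}_c$ ($n\ge1$) and $n_{p,q}:\mathcal{H}_c^{\wedge p}\otimes\mathcal{H}_o^{\otimes q}\to\mathcal{H}_o$ ($p+q\ge1$) such that $(\mathcal{H}_c,\{l_n\})$ is an $L_\infty$-algebra and for all $n,m\ge0$ with $n+m\geq 1$, $v_i\in\mathcal{H}_c$, $a_j\in\mathcal{H}_o$: $$\sum_{p+r=n,\,p\ge1}\sum_{\sigma\in\mathfrak{S}_{p,r}}(-1)^{\epsilon(\sigma)}n_{1+r,m}(l_p(v_{\sigma(1)},\dots,v_{\sigma(p)}),v_{\sigma(p+1)},\dots,v_{\sigma(n)},a_1,\dots,a_m)$$ $$+\sum_{p+r=n}\ \sum_{\sigma\in\mathfrak{S}_{p,r}}\ \sum_{i+s+j=m,\ r+s\ge1}(-1)^{\mu_{p,i}(\sigma)}n_{p,i+1+j}(v_{\sigma(1)},\dots,v_{\sigma(p)},a_1,\dots,a_i,n_{r,s}(v_{\sigma(p+1)},\dots,v_{\sigma(n)},a_{i+1},\dots,a_{i+s}),a_{i+s+1},\dots,a_m)=0,$$ where $\mu_{p,i}(\sigma)=\epsilon(\sigma)+(v_{\sigma(1)}+\cdots+v_{\sigma(p)})+(a_1+\cdots+a_i)+(a_1+\cdots+a_i)(v_{\sigma(p+1)}+\cdots+v_{\sigma(n)})$. *)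

(* Defs.v *)
From HB Require Import structures.
From mathcomp Require Import all_boot all_order all_fingroup all_algebra.

Set Implicit Arguments.
Unset Strict Implicit.
Unset Printing Implicit Defensive.

Import GRing.Theory.
Local Open Scope ring_scope.

Definition graded (k : fieldType) := int -> lmodType k.

Definition homog (k : fieldType) (V : graded k) := {d : int & V d}.

(* The word [:: x_1; ...; x_n] stands for the tensor x_1 (x) ... (x) x_n. *)
Definition word (k : fieldType) (V : graded k) := seq (homog V).

Definition wdeg (k : fieldType) (V : graded k) (w : word V) : int :=
  \sum_(x <- w) tag x.

(* A whole family (f_n)_n of maps from V^{(x) n} to W: f_n is the restriction *)
(* of f to the words of length n, and f w e is the component of degree e of   *)
(* the value of f at w.                                                       *)
Definition op (k : fieldType) (V W : graded k) := word V -> forall e : int, W e.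

Definition multilinear (k : fieldType) (V W : graded k) (f : op V W) : Prop :=
  forall (u v : word V) (d e : int),
    linear (fun x : V d => f (u ++ Tagged V x :: v) e).

(* The empty word is excluded: families of maps start with n = 1, and the     *)
(* value of an op at [::] is never used.                                      *)
Definition degree_one (k : fieldType) (V W : graded k) (f : op V W) : Prop :=
  forall (w : word V) (e : int), w != [::] -> e != 1 + wdeg w -> f w e = 0.

(* For f of degree one, the value f(w) as a homogeneous element. *)
Definition hval (k : fieldType) (V W : graded k) (f : op V W) (w : word V) :
  homog W := Tagged W (f w (1 + wdeg w)).

Definition permw (T : Type) (n : nat) (w : n.-tuple T) (s : 'S_n) : n.-tuple T :=
  [tuple tnth w (s i) | i < n].

(* The exponent epsilon(s): passing from x_1 ... x_n to x_{s(1)} ... x_{s(n)} *)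
(* interchanges exactly the pairs put in inverse order by s.                  *)
Definition koszul (k : fieldType) (V : graded k) (n : nat)
    (w : n.-tuple (homog V)) (s : 'S_n) : int :=
  \sum_(i < n) \sum_(j < n | (i < j)%N && (s j < s i)%N)
     tag (tnth w (s i)) * tag (tnth w (s j)).

Definition unshuffle (n a : nat) (s : 'S_n) : bool :=
  [forall i : 'I_n, forall j : 'I_n,
     (i < j)%N && ((j < a)%N || (a <= i)%N) ==> (s i < s j)%N].

(* The sign is the one of 1^{(x) i} (x) m_s (x) 1^{(x) j}, with m_s of degree *)
(* one, evaluated at w.                                                       *)
Definition Ainfty_relation (k : fieldType) (V : graded k) (m : op V V) : Prop :=
  forall (w : word V) (e : int), w != [::] ->
    \sum_(i < (size w).+1)
      \sum_(s < (size w).+1 | (0 < s)%N && (i + s <= size w)%N)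
        ((-1) ^ wdeg (take i w) : k) *:
          m (take i w ++ hval m (take s (drop i w)) :: drop (i + s) w) e = 0.

Record is_Ainfty (k : fieldType) (V : graded k) (m : op V V) : Prop := IsAinfty {
  Ainfty_multilinear : multilinear m;
  Ainfty_degree : degree_one m;
  Ainfty_rel : Ainfty_relation m
}.

Definition gmap (k : fieldType) (V W : graded k) :=
  forall d : int, {linear V d -> W d}.

Definition hmap (k : fieldType) (V W : graded k) (f : forall d : int, V d -> W d)
  (x : homog V) : homog W := Tagged W (f (tag x) (tagged x)).

Definition linear_Ainfty_morphism (k : fieldType) (V W : graded k)
    (m : op V V) (m' : op W W) (f : gmap V W) : Prop :=
  forall (w : word V) (e : int), w != [::] ->
    f e (m w e) = m' (map (hmap f) w) e.

Record short_exact (k : fieldType) (A E B : graded k)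
    (iota : gmap A E) (p : gmap E B) : Prop := ShortExact {
  short_exact_inj : forall d, injective (iota d);
  short_exact_surj : forall d (b : B d), exists x : E d, p d x = b;
  short_exact_mid : forall d (x : E d),
    p d x = 0 <-> exists a : A d, iota d a = x
}.

Record is_Ainfty_extension (k : fieldType) (A E B : graded k)
    (mA : op A A) (mE : op E E) (mB : op B B)
    (iota : gmap A E) (p : gmap E B) : Prop := IsAinftyExtension {
  extension_Ainfty : is_Ainfty mE;
  extension_exact : short_exact iota p;
  extension_iota : linear_Ainfty_morphism mA mE iota;
  extension_p : linear_Ainfty_morphism mE mB p
}.

Definition gsum (k : fieldType) (V W : graded k) : graded k :=
  fun d => (V d * W d)%type : lmodType k.

Section Splitting.

Variables (k : fieldType) (A E B : graded k).
Variables (iota : gmap A E) (p : gmap E B) (s : gmap B E).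

(* The summands come in the order (closed, open) = (B, A) used by Xi below. *)
Definition split_iso (d : int) (x : gsum B A d) : E d :=
  iota d x.2 + s d x.1.

Hypothesis ex : short_exact iota p.
Hypothesis sK : forall d, cancel (s d) (p d).

Lemma split_iso_surj (d : int) (y : E d) : exists x, split_iso x == y.
Proof.
have [|a Ha] := (short_exact_mid ex (y - s d (p d y))).1.
  by rewrite linearB /= sK subrr.
by exists (p d y, a); rewrite /split_iso /= Ha subrK.
Qed.

(* The inverse of split_iso, that is, the identification of E with the direct *)
(* sum given by the splitting s.                                              *)
Definition split_inv (d : int) (y : E d) : gsum B A d :=
  xchoose (split_iso_surj y).

Lemma split_invK (d : int) : cancel (@split_inv d) (@split_iso d).
Proof. by move=> y; apply/eqP; exact: (xchooseP (split_iso_surj y)). Qed.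

Lemma split_isoK (d : int) : cancel (@split_iso d) (@split_inv d).
Proof.
have pi0 a : p d (iota d a) = 0 by apply/(short_exact_mid ex); exists a.
move=> [b' a']; have := split_invK (split_iso (b', a')).
case: (split_inv (split_iso (b', a'))) => b a; rewrite /split_iso /= => eq_ba.
have eq_b : b = b'.
  by have := congr1 (p d) eq_ba; rewrite !linearD /= !pi0 !sK !add0r.
move: eq_ba; rewrite eq_b => /addIr /(short_exact_inj ex) -> //.
Qed.

(* The structure D transported from E to the direct sum of B and A. *)
Definition split_op (D : op E E) : op (gsum B A) (gsum B A) :=
  fun w e => split_inv (D (map (hmap split_iso) w) e).

End Splitting.

(* A finite formal linear combination of words, representing an element of    *)
(* the tensor coalgebra: multilinear families of maps are applied to it by    *)
(* apply_op.                                                                  *)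
Definition tensors (k : fieldType) (V : graded k) := seq (k * word V).

Definition apply_op (k : fieldType) (V W : graded k) (f : op V W)
    (t : tensors V) (e : int) : W e :=
  \sum_(c <- t) c.1 *: f c.2 e.

Definition chi (k : fieldType) (V : graded k) (c : word V) : tensors V :=
  [seq ((-1) ^ koszul (in_tuple c) s, permw (in_tuple c) s : word V)
     | s <- enum 'S_(size c)].

Definition Sh (k : fieldType) (V : graded k) (u v : word V) : tensors V :=
  [seq ((-1) ^ koszul (in_tuple (u ++ v)) s,
        permw (in_tuple (u ++ v)) s : word V)
     | s <- enum 'S_(size (u ++ v)) & unshuffle (size u) s^-1%g].

Definition inC (k : fieldType) (C O : graded k) (x : homog C) :
  homog (gsum C O) := Tagged (gsum C O) ((tagged x, 0) : gsum C O (tag x)).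

Definition inO (k : fieldType) (C O : graded k) (x : homog O) :
  homog (gsum C O) := Tagged (gsum C O) ((0, tagged x) : gsum C O (tag x)).

Definition Xi (k : fieldType) (C O : graded k) (c : word C) (o : word O) :
    tensors (gsum C O) :=
  flatten [seq [seq (t.1 * t'.1, t'.2)
                  | t' <- Sh (map (@inC k C O) t.2) (map (@inO k C O) o)]
             | t <- chi c].

Definition graded_symmetric (k : fieldType) (V W : graded k) (f : op V W) : Prop :=
  forall (n : nat) (w : n.-tuple (homog V)) (s : 'S_n) (e : int),
    f w e = ((-1) ^ koszul w s : k) *: f (permw w s) e.

Definition Linfty_relation (k : fieldType) (V : graded k) (l : op V V) : Prop :=
  forall (n : nat) (v : n.-tuple (homog V)) (e : int), (0 < n)%N ->
    \sum_(p < n.+1 | (0 < p)%N) \sum_(s : 'S_n | unshuffle p s)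
      ((-1) ^ koszul v s : k) *:
        l (hval l (take p (permw v s)) :: drop p (permw v s)) e = 0.

Record is_Linfty (k : fieldType) (V : graded k) (l : op V V) : Prop := IsLinfty {
  Linfty_multilinear : multilinear l;
  Linfty_degree : degree_one l;
  Linfty_symmetric : graded_symmetric l;
  Linfty_rel : Linfty_relation l
}.

(* A whole family (n_{p,q})_{p,q}, indexed by the lengths of the two words. *)
Definition op2 (k : fieldType) (C O : graded k) :=
  word C -> word O -> forall e : int, O e.

Definition hval2 (k : fieldType) (C O : graded k) (f : op2 C O)
    (v : word C) (a : word O) : homog O :=
  Tagged O (f v a (1 + (wdeg v + wdeg a))).

Definition OCHA_relation (k : fieldType) (C O : graded k)
    (l : op C C) (nn : op2 C O) : Prop :=
  forall (n m : nat) (v : n.-tuple (homog C)) (a : m.-tuple (homog O)) (e : int),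
    (0 < n + m)%N ->
    (\sum_(p < n.+1 | (0 < p)%N) \sum_(s : 'S_n | unshuffle p s)
       ((-1) ^ koszul v s : k) *:
         nn (hval l (take p (permw v s)) :: drop p (permw v s)) a e)
    + \sum_(p < n.+1) \sum_(s : 'S_n | unshuffle p s)
        \sum_(i < m.+1)
          \sum_(t < m.+1 | (i + t <= m)%N && (0 < (n - p) + t)%N)
        (let v1 := take p (permw v s) in
         let v2 := drop p (permw v s) in
         let a1 := take i a in
         let a2 := take t (drop i a) in
         let a3 := drop (i + t) a in
         ((-1) ^ (koszul v s + wdeg v1 + wdeg a1 + wdeg a1 * wdeg v2) : k) *:
           nn v1 (a1 ++ hval2 nn v2 a2 :: a3) e)
    = 0.

Record is_OCHA (k : fieldType) (C O : graded k) (l : op C C) (nn : op2 C O) :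
  Prop := IsOCHA {
  OCHA_Linfty : is_Linfty l;
  OCHA_multilinear_C : forall a : word O, multilinear (fun v => nn v a);
  OCHA_multilinear_O : forall v : word C, multilinear (nn v);
  OCHA_degree : forall (v : word C) (a : word O) (e : int),
    (0 < size v + size a)%N -> e != 1 + (wdeg v + wdeg a) -> nn v a e = 0;
  OCHA_symmetric : forall a : word O, graded_symmetric (fun v => nn v a);
  OCHA_rel : OCHA_relation l nn
}.

Definition Lada_Markl (k : fieldType) (V : graded k) (m : op V V) : op V V :=
  fun w e => \sum_(s : 'S_(size w))
    ((-1) ^ koszul (in_tuple w) s : k) *: m (permw (in_tuple w) s) e.

(* The two components of the composite of D, an op on the direct sum, with Xi. *)
Definition Xi_l (k : fieldType) (C O : graded k)
    (D : op (gsum C O) (gsum C O)) : op C C :=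
  fun c e => (apply_op D (Xi c [::]) e).1.

Definition Xi_n (k : fieldType) (C O : graded k)
    (D : op (gsum C O) (gsum C O)) : op2 C O :=
  fun c o e => (apply_op D (Xi c o) e).2.

(* Main.v *)
(* Write S_x for the shuffle product with a single letter x, an operator on   *)
(* tensors, so that Xi(c_1 ... c_p; o) = S_{c_1} ... S_{c_p} o. If Dhat_b is  *)
(* the coderivation of the tensor coalgebra with components D S_{b_1} ...     *)
(* S_{b_q}, then the graded commutator of Dhat_b and S_x is again such a      *)
(* coderivation, namely Dhat_{bx}. Moving Dhat past S_{c_1}, ..., S_{c_p}     *)
(* thus gives                                                                 *)
(*   Dhat Xi(c; o) = sum of +- S_{c'} Dhat_{c''} o                            *)
(* over the unshuffles (c', c'') of c. After applying D, the left side        *)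
(* vanishes by the A_infinity relation. On the right, each inner value        *)
(* D(Xi(c''; a)), with a a factor of o, is split into its two components. The *)
(* component in A is n(c''; a), and produces the terms n(c'; ..., n(c''; a),  *)
(* ...). The component in B vanishes unless a is empty, because A is an ideal *)
(* of E; for a empty it is z = l(c''), and its sum over all positions in o is *)
(* S_z o, which produces the terms n(l(c''), c'; o). With o empty and D       *)
(* followed by the projection to B, only the terms l(l(c''), c') survive,     *)
(* which is the L_infinity relation.                                          *)

Require Import Defs.
From HB Require Import structures.
From mathcomp Require Import all_boot all_order all_fingroup all_algebra.
From mathcomp Require Import ssrAC ring zify.

Set Implicit Arguments.
Unset Strict Implicit.
Unset Printing Implicit Defensive.

Import GRing.Theory.
Local Open Scope ring_scope.

(** * Signs, insertions and coderivations *)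

(** The $A_\infty$ relation says that $\mathcal D$ composed with its coderivation $\hat{\mathcal D}$
    of the tensor coalgebra is zero, so it also vanishes on every $\Xi(c;o)$. The OCHA and
    $L_\infty$ relations are the two components of this one identity, rewritten by moving
    $\hat{\mathcal D}$ through the shuffles.

    Tensors are handled through functionals on words: an operator on tensors becomes a
    precomposition, and coproducts become the sums [cut2], [cut3] (deconcatenation) and [unsh]
    (unshuffles). The commutation is [ins_cod], iterated in [xi_cod]; [cod_D0] restates the
    $A_\infty$ relation; [xi_hval_D0] splits an inner value into its open and closed parts. The
    closed part survives only without open inputs, since $A$ is the kernel of the strict morphism
    [p] and hence an ideal. These combine in [unsh_Xi_relation].

    The sums over permutations in the definitions are matched with the recursive operators by
    [sum_perm_xi], [sum_unshuffle] and [sum_Sh]; with associativity of the shuffle product they give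
    [apply_op_Xi]. Finally [split_op_Ainfty] and [split_op_fst] carry the structure of $E$ to the
    direct sum. *)

Section Signs.

Variable k : fieldType.

Lemma signD (x y : int) : (-1) ^ (x + y) = (-1) ^ x * (-1) ^ y :> k.
Proof. by apply: expfzDr; rewrite oppr_eq0 oner_eq0. Qed.

Lemma sign_sqr (x : int) : (-1) ^ x * (-1) ^ x = 1 :> k.
Proof. by rewrite -expfzMl mulrNN mulr1 exp1rz. Qed.

(** Exponents matter only modulo 2; naming half of the difference as [z] reduces a comparison of
    signs to an identity for [ring]. *)
Lemma sign_eq (z x y : int) : x = y + z + z -> (-1) ^ x = (-1) ^ y :> k.
Proof. by move->; rewrite !signD -mulrA sign_sqr mulr1. Qed.

End Signs.

Arguments sign_eq {k} z {x y}.

Section Degrees.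

Variables (k : fieldType) (V : graded k).
Implicit Types (x : homog V) (u v w : word V).

Lemma wdeg_nil : wdeg ([::] : word V) = 0.
Proof. exact: big_nil. Qed.

Lemma wdeg_cons x w : wdeg (x :: w) = tag x + wdeg w.
Proof. exact: big_cons. Qed.

Lemma wdeg_cat u v : wdeg (u ++ v) = wdeg u + wdeg v.
Proof. exact: big_cat. Qed.

Lemma wdeg_rcons w x : wdeg (rcons w x) = wdeg w + tag x.
Proof. by rewrite -cats1 wdeg_cat wdeg_cons wdeg_nil addr0. Qed.

Lemma wdeg_map (W : graded k) (f : homog V -> homog W) w :
  (forall x, tag (f x) = tag x) -> wdeg (map f w) = wdeg w.
Proof. by move=> fE; rewrite /wdeg big_map; under eq_bigr do rewrite fE. Qed.

End Degrees.

(** * Shuffling with single letters, and deconcatenation *)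

Section Shuffles.

Variables (k : fieldType) (V : graded k) (M : lmodType k).
Implicit Types (x y : homog V) (c u v w : word V) (F G : word V -> M).

(* A linear functional on tensors is given by its values F on words, and the *)
(* operators on tensors act on F by precomposition: ins x F w is the value of *)
(* F on the shuffle product S_x w, and xi c F w its value on                  *)
(* S_{c_1} ... S_{c_p} w.                                                     *)
Fixpoint ins x F w : M :=
  if w is y :: w' then
    F (x :: w) + ((-1) ^ (tag x * tag y) : k) *: ins x (F \o cons y) w'
  else F [:: x].

Definition xi c F : word V -> M := foldl (fun G x => ins x G) F c.

Lemma xi_cons x c F : xi (x :: c) F = xi c (ins x F).
Proof. by []. Qed.

Lemma xi_rcons c x F : xi (rcons c x) F = ins x (xi c F).
Proof. by rewrite /xi foldl_rcons. Qed.

Lemma xi_cat c c' F : xi (c ++ c') F = xi c' (xi c F).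
Proof. by rewrite /xi foldl_cat. Qed.

(** Only words of one fixed length and degree are reached. This allows signs depending on the degree
    to be treated as constants, and the empty word to be ignored. *)
Lemma eq_ins_size x F G w :
  (forall u, size u = (size w).+1 -> wdeg u = tag x + wdeg w -> F u = G u) ->
  ins x F w = ins x G w.
Proof.
elim: w F G => [|y w IHw] F G eqFG /=.
  by apply: eqFG; rewrite // wdeg_cons wdeg_nil.
rewrite eqFG ?wdeg_cons //; congr (_ + _ *: _); apply: IHw => u su du /=.
by apply: eqFG; rewrite /= ?su // !wdeg_cons du addrCA.
Qed.

Lemma eq_ins x F G : F =1 G -> ins x F =1 ins x G.
Proof. by move=> eqFG w; apply: eq_ins_size => u _ _. Qed.

Lemma eq_xi_size c F G w :
  (forall u, size u = (size c + size w)%N -> wdeg u = wdeg c + wdeg w ->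
     F u = G u) ->
  xi c F w = xi c G w.
Proof.
elim: c F G => [|x c IHc] F G eqFG; first by apply: eqFG; rewrite ?wdeg_nil ?add0r.
rewrite !xi_cons; apply: IHc => u su du; apply: eq_ins_size => u' su' du'.
by apply: eqFG; rewrite ?su' ?su ?addSn // du' du wdeg_cons addrA.
Qed.

Lemma eq_xi c F G : F =1 G -> xi c F =1 xi c G.
Proof. by move=> eqFG w; apply: eq_xi_size => u _ _. Qed.

Lemma insP x F G (a : k) w :
  ins x (fun u => a *: F u + G u) w = a *: ins x F w + ins x G w.
Proof.
elim: w F G => [|y w IHw] F G //=; rewrite (IHw (F \o cons y) (G \o cons y)).
by rewrite !scalerDr !scalerA [_ * a]mulrC -!addrA; congr (_ + _); rewrite addrCA.
Qed.

Lemma insD x F G w : ins x (fun u => F u + G u) w = ins x F w + ins x G w.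
Proof.
by rewrite -[ins x F w]scale1r -insP; apply: eq_ins => u; rewrite scale1r.
Qed.

Lemma ins0 x w : ins x (fun=> 0) w = 0.
Proof.
by rewrite (@eq_ins x _ (fun=> (-1) *: 0 + 0)) ?insP ?scaleN1r ?addNr // => u;
  rewrite scaler0 addr0.
Qed.

Lemma insZ x F (a : k) w : ins x (fun u => a *: F u) w = a *: ins x F w.
Proof.
by rewrite -[RHS]addr0 -(ins0 x w) -insP; apply: eq_ins => u; rewrite addr0.
Qed.

Lemma xiP c F G (a : k) w :
  xi c (fun u => a *: F u + G u) w = a *: xi c F w + xi c G w.
Proof.
elim: c F G => [|x c IHc] F G //; rewrite !xi_cons -IHc.
by apply: eq_xi => u; apply: insP.
Qed.

Lemma xiD c F G w : xi c (fun u => F u + G u) w = xi c F w + xi c G w.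
Proof.
by rewrite -[xi c F w]scale1r -xiP; apply: eq_xi => u; rewrite scale1r.
Qed.

Lemma xi0 c w : xi c (fun=> 0) w = 0.
Proof.
by elim: c => [|x c IHc] //; rewrite xi_cons -[RHS]IHc; apply: eq_xi => u; apply: ins0.
Qed.

Lemma xiZ c F (a : k) w : xi c (fun u => a *: F u) w = a *: xi c F w.
Proof.
by rewrite -[RHS]addr0 -(xi0 c w) -xiP; apply: eq_xi => u; rewrite addr0.
Qed.

(** Both sides run over the same ways of inserting the two letters; the coefficients differ by the
    sign of exchanging them. This is the source of the graded symmetry of $l_n$ and $n_{p,q}$. *)
Lemma insC x y F w :
  ins x (ins y F) w = ((-1) ^ (tag x * tag y) : k) *: ins y (ins x F) w.
Proof.
pose e (a b : homog V) : k := (-1) ^ (tag a * tag b).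
have eC a b : e a b = e b a by rewrite /e mulrC.
have ee a b : e a b * e a b = 1 by apply: sign_sqr.
elim: w F => [|z w IHw] F /=; rewrite -!/(e _ _).
  by rewrite scalerDr scalerA (eC y x) ee scale1r addrC.
have insE (a b : homog V) : ins a (ins b F \o cons z) w =
    ins a (F \o cons b \o cons z) w + e b z *: ins a (ins b (F \o cons z)) w.
  by rewrite -insZ -insD.
rewrite !insE IHw -!/(e _ _) (eC y x) !scalerDr !scalerA ee scale1r.
rewrite mul1r [e x z * e y z]mulrC -[_ * _ * e x y]mulrA mulrCA -mulrA.
rewrite [F [:: y, x, z & w] + _]addrCA -!addrA; congr (_ + (_ + _)).
rewrite addrCA; congr (_ + (_ + _ *: _)).
by ring.
Qed.

Lemma xi_insC c x F w :
  xi c (ins x F) w = ((-1) ^ (tag x * wdeg c) : k) *: ins x (xi c F) w.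
Proof.
elim: c F => [|y c IHc] F /=; first by rewrite wdeg_nil mulr0 scale1r.
rewrite (eq_xi _ (insC y x F)) xiZ IHc scalerA wdeg_cons mulrDr signD.
by rewrite [tag y * _]mulrC.
Qed.

Lemma xi_swap c c' x y F w :
  xi (c ++ x :: y :: c') F w =
  ((-1) ^ (tag x * tag y) : k) *: xi (c ++ y :: x :: c') F w.
Proof.
rewrite !xi_cat !xi_cons -xiZ; apply: eq_xi => u.
by rewrite insC mulrC.
Qed.

Lemma xi_move c x F w :
  xi (rcons c x) F w = ((-1) ^ (tag x * wdeg c) : k) *: xi (x :: c) F w.
Proof. by rewrite xi_rcons xi_cons xi_insC scalerA sign_sqr scale1r. Qed.

Fixpoint cut2 w (P : word V -> word V -> M) : M :=
  if w is x :: w' then P [::] w + cut2 w' (P \o cons x) else P [::] [::].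

Definition cut3 w (P : word V -> word V -> word V -> M) : M :=
  cut2 w (fun u r => cut2 r (P u)).

Lemma eq_cut2 w (P Q : word V -> word V -> M) :
  (forall u v, w = u ++ v -> P u v = Q u v) -> cut2 w P = cut2 w Q.
Proof.
elim: w P Q => [|x w IHw] P Q eqPQ /=; first exact: eqPQ.
by rewrite eqPQ //; congr (_ + _); apply: IHw => u v Ew /=; apply: eqPQ; rewrite Ew.
Qed.

Lemma eq_cut3 w (P Q : word V -> word V -> word V -> M) :
  (forall u m v, w = u ++ m ++ v -> P u m v = Q u m v) -> cut3 w P = cut3 w Q.
Proof.
move=> eqPQ; apply: eq_cut2 => u r Ew; apply: eq_cut2 => m v Er.
by apply: eqPQ; rewrite Ew Er.
Qed.

Lemma cut2P w (P Q : word V -> word V -> M) (a : k) :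
  cut2 w (fun u v => a *: P u v + Q u v) = a *: cut2 w P + cut2 w Q.
Proof.
elim: w P Q => [|x w IHw] P Q //=.
by rewrite scalerDr addrACA -IHw.
Qed.

Lemma cut2D w (P Q : word V -> word V -> M) :
  cut2 w (fun u v => P u v + Q u v) = cut2 w P + cut2 w Q.
Proof.
by rewrite -[cut2 w P]scale1r -cut2P; apply: eq_cut2 => u v _; rewrite scale1r.
Qed.

Lemma cut2_0 w : cut2 w (fun _ _ => 0) = 0.
Proof. by elim: w => //= x w IHw; rewrite add0r -[RHS]IHw. Qed.

Lemma cut2Z w (P : word V -> word V -> M) (a : k) :
  cut2 w (fun u v => a *: P u v) = a *: cut2 w P.
Proof.
by rewrite -[RHS]addr0 -(cut2_0 w) -cut2P; apply: eq_cut2 => u v _; rewrite addr0.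
Qed.

Lemma cut3D w (P Q : word V -> word V -> word V -> M) :
  cut3 w (fun u m v => P u m v + Q u m v) = cut3 w P + cut3 w Q.
Proof. by rewrite -cut2D; apply: eq_cut2 => u r _; rewrite cut2D. Qed.

Lemma cut3Z w (P : word V -> word V -> word V -> M) (a : k) :
  cut3 w (fun u m v => a *: P u m v) = a *: cut3 w P.
Proof. by rewrite -cut2Z; apply: eq_cut2 => u r _; rewrite cut2Z. Qed.

Lemma cut2E w P :
  cut2 w P = \sum_(i < (size w).+1) P (take i w) (drop i w).
Proof.
elim: w P => [|x w IHw] P /=; first by rewrite big_ord1.
by rewrite big_ord_recl IHw.
Qed.

Lemma cut3E w P :
  cut3 w P = \sum_(i < (size w).+1)
    \sum_(s < (size w).+1 | (i + s <= size w)%N)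
      P (take i w) (take s (drop i w)) (drop (i + s) w).
Proof.
rewrite /cut3 cut2E; apply: eq_bigr => i _; rewrite cut2E size_drop.
rewrite (big_ord_widen (size w).+1 (fun s => P (take i w) (take s (drop i w))
  (drop s (drop i w)))) ?ltnS ?leq_subr //.
by apply: eq_big => [s|s _]; rewrite ?drop_drop 1?addnC //; have := ltn_ord i; lia.
Qed.

Lemma insE x F w :
  ins x F w =
  cut2 w (fun u v => ((-1) ^ (tag x * wdeg u) : k) *: F (u ++ x :: v)).
Proof.
elim: w F => [|y w IHw] F /=; rewrite wdeg_nil mulr0 scale1r //.
rewrite IHw -cut2Z; congr (_ + _); apply: eq_cut2 => u v _ /=.
by rewrite scalerA -signD wdeg_cons mulrDr.
Qed.

(* The inserted letter falls on either side of the cut. *)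
Lemma ins_cut2 x (P : word V -> word V -> M) w :
  ins x (fun u => cut2 u P) w =
  cut2 w (fun u v => ins x (P^~ v) u +
    ((-1) ^ (tag x * wdeg u) : k) *: ins x (P u) v).
Proof.
elim: w P => [|y w IHw] P /=; first by rewrite wdeg_nil mulr0 scale1r addrC.
have -> : ins x ((fun u => cut2 u P) \o cons y) w =
    ins x (fun u => P [::] (y :: u)) w + ins x (fun u => cut2 u (P \o cons y)) w.
  by rewrite -insD.
rewrite IHw wdeg_nil mulr0 scale1r scalerDr -cut2Z -!addrA addrCA; congr (_ + _).
congr (_ + _); rewrite addrCA; congr (_ + _); rewrite -cut2D; apply: eq_cut2 => u v _ /=.
by rewrite scalerDr scalerA -signD wdeg_cons -mulrDr addrA.
Qed.

Lemma ins_cut3 x (P : word V -> word V -> word V -> M) w :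
  ins x (fun u => cut3 u P) w =
  cut3 w (fun u m v => ins x (fun u' => P u' m v) u +
    ((-1) ^ (tag x * wdeg u) : k) *: ins x (P u ^~ v) m +
    ((-1) ^ (tag x * (wdeg u + wdeg m)) : k) *: ins x (P u m) v).
Proof.
rewrite /cut3 ins_cut2; apply: eq_cut2 => u r _.
rewrite ins_cut2 -cut2Z.
have -> : ins x (fun u' => cut2 r (P u')) u =
    cut2 r (fun m v => ins x (fun u' => P u' m v) u).
  elim: r P => [|y r IHr] P //=; rewrite insD -IHr; congr (_ + _).
rewrite -cut2D; apply: eq_cut2 => m v _.
by rewrite scalerDr scalerA -signD -mulrDr addrA.
Qed.

End Shuffles.

Section ShufflesTheory.

Variables (k : fieldType) (V : graded k) (M : lmodType k).
Implicit Types (x y : homog V) (b c u v w : word V) (F G : word V -> M).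

(** There is no Koszul sign, because the insertions concern separate arguments of [H] and each
    carries only the sign internal to its own word. *)
Lemma ins_ins x y (H : word V -> word V -> M) u v :
  ins x (fun u' => ins y (H u') v) u = ins y (fun v' => ins x (H^~ v') u) v.
Proof.
elim: u H => [|z u IHu] H //=.
rewrite -/(ins y) insD insZ; congr (_ + _ *: _).
exact: (IHu (fun u' => H (z :: u'))).
Qed.

Lemma ins_xi x c (H : word V -> word V -> M) u v :
  ins x (fun u' => xi c (H u') v) u = xi c (fun v' => ins x (H^~ v') u) v.
Proof.
elim: c H => [|y c IHc] H //.
rewrite xi_cons (IHc (fun u' => ins y (H u'))).
by apply: eq_xi => v'; apply: ins_ins.
Qed.

Lemma ins_cat x F u y v :
  ins x F (u ++ y :: v) = ins x (fun u' => F (u' ++ y :: v)) u +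
    ((-1) ^ (tag x * (wdeg u + tag y)) : k) *:
      ins x (fun v' => F (u ++ y :: v')) v.
Proof.
elim: u F => [|z u IHu] F /=; first by rewrite wdeg_nil add0r.
rewrite IHu scalerDr scalerA -signD wdeg_cons -addrA; congr (_ + (_ + _ *: _)).
by rewrite -mulrDr addrA.
Qed.

Definition multilin F : Prop :=
  forall u v (d : int), linear (fun x : V d => F (u ++ Tagged V x :: v)).

Lemma ins_multilin x F : multilin F -> multilin (ins x F).
Proof.
move=> Flin u v d a y z; rewrite !ins_cat /=.
under eq_ins do rewrite Flin.
rewrite insP.
have -> : ins x (fun v' => F (u ++ Tagged V (a *: y + z) :: v')) v =
    a *: ins x (fun v' => F (u ++ Tagged V y :: v')) v +
    ins x (fun v' => F (u ++ Tagged V z :: v')) v.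
  by rewrite -insP; apply: eq_ins => v'; rewrite Flin.
by rewrite !scalerDr !scalerA [_ * a]mulrC addrACA.
Qed.

Lemma xi_multilin c F : multilin F -> multilin (xi c F).
Proof. by elim: c F => [|x c IHc] F Flin //; apply/IHc/ins_multilin. Qed.

Lemma ins_linear F w d : multilin F -> linear (fun x : V d => ins (Tagged V x) F w).
Proof.
move=> Flin a x y; rewrite !insE /= -cut2P; apply: eq_cut2 => u v _.
by rewrite Flin scalerDr !scalerA mulrC.
Qed.

Lemma xi_linear u v F w d :
  multilin F -> linear (fun x : V d => xi (u ++ Tagged V x :: v) F w).
Proof.
move=> Flin a x y; rewrite !xi_cat !xi_cons -xiP; apply: eq_xi => w'.
by apply: ins_linear; apply: xi_multilin.
Qed.

(* The signed sum of G over all unshuffles of c into two words. *)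
Fixpoint unsh c (G : word V -> word V -> M) : M :=
  if c is x :: c' then
    unsh c' (G \o cons x) +
    unsh c' (fun a b => ((-1) ^ (tag x * wdeg a) : k) *: G a (x :: b))
  else G [::] [::].

Lemma eq_unsh c (G H : word V -> word V -> M) :
  (forall a b, size c = (size a + size b)%N -> wdeg c = wdeg a + wdeg b ->
     G a b = H a b) ->
  unsh c G = unsh c H.
Proof.
elim: c G H => [|x c IHc] G H eqGH /=; first by apply: eqGH; rewrite ?wdeg_nil ?addr0.
by congr (_ + _); apply: IHc => a b sc dc /=; rewrite eqGH //=
  ?sc ?addSn ?addnS // !wdeg_cons dc; ring.
Qed.

Lemma unshP c (G H : word V -> word V -> M) (a : k) :
  unsh c (fun u v => a *: G u v + H u v) = a *: unsh c G + unsh c H.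
Proof.
elim: c G H => [|x c IHc] G H //=.
rewrite scalerDr addrACA -!IHc; congr (_ + _); apply: eq_unsh => u v _ _.
by rewrite scalerDr !scalerA mulrC.
Qed.

Lemma unshD c (G H : word V -> word V -> M) :
  unsh c (fun u v => G u v + H u v) = unsh c G + unsh c H.
Proof.
by rewrite -[unsh c G]scale1r -unshP; apply: eq_unsh => u v _ _; rewrite scale1r.
Qed.

Lemma unsh0 c : unsh c (fun _ _ => 0) = 0.
Proof.
by rewrite (@eq_unsh _ _ (fun _ _ => (-1) *: 0 + 0)) => [|u v _ _];
  rewrite ?unshP ?scaleN1r ?addNr.
Qed.

Lemma unshZ c (G : word V -> word V -> M) (a : k) :
  unsh c (fun u v => a *: G u v) = a *: unsh c G.
Proof.
by rewrite -[RHS]addr0 -(unsh0 c) -unshP; apply: eq_unsh => u v _ _; rewrite addr0.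
Qed.

(** Graded cocommutativity of the unshuffle coproduct: the branch sending [x] to the left is matched
    with the one sending it to the right. *)
Lemma unsh_swap c (G : word V -> word V -> M) :
  unsh c G = unsh c (fun a b => ((-1) ^ (wdeg a * wdeg b) : k) *: G b a).
Proof.
elim: c G => [|x c IHc] G /=; first by rewrite wdeg_nil mul0r scale1r.
rewrite addrC (IHc (G \o cons x)) IHc; congr (_ + _).
  apply: eq_unsh => a b _ _ /=; rewrite scalerA -signD wdeg_cons.
  by congr (_ ^ _ *: _); ring.
apply: eq_unsh => a b _ _ /=; rewrite scalerA -signD wdeg_cons.
by congr (_ *: _); apply: (sign_eq (- (tag x * wdeg a))); ring.
Qed.

(** * Commuting coderivations with shuffles *)

Section Coderivation.

Variable D : op V V.

(* The value of F on Dhat_b w, where Dhat_b is the coderivation of degree     *)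
(* 1 + wdeg b with components m |-> D (S_{b_1} ... S_{b_q} m).                *)
Definition cod b F w : M :=
  cut3 w (fun u m v => ((-1) ^ ((1 + wdeg b) * wdeg u) : k) *:
    xi b (fun m' => F (u ++ hval D m' :: v)) m).

(** The letter [x] falls before, inside or after the factor [m] fed to $\mathcal D$. Inside, it
    joins [b]; the other two cases together are the insertion of [x] into the output word, by
    [ins_cat]. *)
Lemma ins_cod x b F w :
  ins x (cod b F) w =
  ((-1) ^ (tag x * (1 + wdeg b)) : k) *: cod b (ins x F) w + cod (rcons b x) F w.
Proof.
rewrite ins_cut3 -cut3Z -cut3D; apply: eq_cut3 => u m v _.
rewrite -addrA [X in _ + X]addrC addrA; congr (_ + _); last first.
  rewrite insZ scalerA -signD xi_rcons wdeg_rcons; congr (_ *: _).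
  by congr (_ ^ _); ring.
(* The sign attached to the prefix [u'] depends only on its degree, which is that of [x] followed by
   [u], so it can leave the insertion. *)
rewrite (@eq_ins_size _ _ _ _ _ (fun u' =>
  ((-1) ^ ((1 + wdeg b) * (tag x + wdeg u)) : k) *:
    xi b (fun m' => F (u' ++ hval D m' :: v)) m)); last by move=> u' _ ->.
rewrite !insZ ins_xi ins_xi.
rewrite scalerA.
rewrite -[in X in _ + X]xiZ -xiZ -xiD scalerA -xiZ; apply: eq_xi_size => m' _ dm'.
rewrite ins_cat /= dm' !scalerDr !scalerA -!signD.
by congr (_ *: _ + _ *: _); [congr (_ ^ _); ring |];
  apply: (sign_eq (- (tag x * (1 + wdeg b)))); ring.
Qed.

(** By iteration of [ins_cod], each letter of [c] either stays outside (in [c1]) or is absorbed by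
    the coderivation (in [c2]). *)
Lemma xi_cod b c F w :
  xi c (cod b F) w =
  unsh c (fun c1 c2 => ((-1) ^ ((1 + wdeg b) * wdeg c1) : k) *:
    cod (b ++ c2) (xi c1 F) w).
Proof.
elim: c b F => [|x c IHc] b F /=; first by rewrite wdeg_nil mulr0 scale1r cats0.
rewrite (eq_xi _ (ins_cod x b F)) xiP !IHc -unshZ; congr (_ + _).
  apply: eq_unsh => u v _ _ /=; rewrite scalerA -signD wdeg_cons.
  by congr (_ ^ _ *: _); ring.
apply: eq_unsh => u v _ _; rewrite scalerA -signD cat_rcons wdeg_rcons.
by congr (_ ^ _ *: _); ring.
Qed.

End Coderivation.

End ShufflesTheory.

(** * Sums over permutations *)

Section Permutations.

(* A permutation s of 'I_n.+1 is determined by the place i of the letter 0 in *)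
(* the permuted word and by the order of the other letters.                *)
Lemma lift_perm_bij n :
  bijective (fun q : 'I_n.+1 * 'S_n => lift_perm q.1 ord0 q.2).
Proof.
apply: inj_card_bij => [[i s] [j t] /= eq_st|]; last first.
  by rewrite card_prod !card_Sn card_ord factS.
have eq_ij : i = j.
  apply: (@perm_inj _ (lift_perm j ord0 t)).
  by rewrite -[in LHS]eq_st !lift_perm_id.
rewrite -eq_ij in eq_st *; congr (_, _); apply/permP => l.
by apply: (@lift_inj _ ord0); rewrite -!(lift_perm_lift i) eq_st.
Qed.

Lemma sum_lift_perm (R : nmodType) n (P : pred 'S_n.+1) (F : 'S_n.+1 -> R) :
  \sum_(s | P s) F s =
  \sum_(i < n.+1) \sum_(s : 'S_n | P (lift_perm i ord0 s)) F (lift_perm i ord0 s).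
Proof.
rewrite (reindex _ (onW_bij _ (lift_perm_bij n))) /=.
by rewrite (pair_big_dep xpredT (fun i (s : 'S_n) => P (lift_perm i ord0 s))
  (fun i s => F (lift_perm i ord0 s))).
Qed.

Lemma ltn_lift n (h : 'I_n) (i j : 'I_n.-1) : (lift h i < lift h j)%N = (i < j)%N.
Proof. by rewrite /= !ltnNge leq_bump2. Qed.

Lemma lift_ltn n (h : 'I_n) (i : 'I_n.-1) : (lift h i < h)%N = (i < h)%N.
Proof. by rewrite /= /bump; case: leqP; lia. Qed.

Lemma unshuffleP n a (s : 'S_n) :
  reflect (forall i j : 'I_n, (i < j)%N -> (j < a)%N || (a <= i)%N -> (s i < s j)%N)
          (unshuffle a s).
Proof.
apply: (iffP forallP) => [sP i j ij ia | sP i].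
  by move/forallP/(_ j)/implyP: (sP i); apply; rewrite ij.
by apply/forallP => j; apply/implyP => /andP[]; apply: sP.
Qed.

(** Letters increase along each block, so the least letter must head its block: it stands at place 0
    or at place [a]. *)
Lemma unshuffle_lift_perm n a (i : 'I_n.+1) (s : 'S_n) :
  unshuffle a (lift_perm i ord0 s) =
  (i == 0 :> nat) && (0 < a)%N && unshuffle a.-1 s ||
  (i == a :> nat) && unshuffle a s.
Proof.
apply/unshuffleP/idP => [sP | H x y].
  have no (x : 'I_n.+1) : (x < i)%N -> ~~ ((i < a)%N || (a <= x)%N).
    by move=> xi; apply/negP => /(sP _ _ xi); rewrite lift_perm_id.
  have sh (x y : 'I_n) : (x < y)%N -> (lift i y < a)%N || (a <= lift i x)%N ->
      (s x < s y)%N.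
    by move=> xy /(sP (lift i x) (lift i y)); rewrite !lift_perm_lift !ltn_lift; apply.
  have [i0|i_gt0] := posnP i.
    case: (posnP a) => [a0|a_gt0]; rewrite ?i0 ?a0 /= ?(ltn_eqF a_gt0) ?orbF.
      by apply/unshuffleP => x y xy _; apply: sh xy _; rewrite a0 orbT.
    apply/unshuffleP => x y xy ay; apply: sh xy _; move: ay.
    by rewrite /= /bump i0 /=; lia.
  have eq_ia : i = a :> nat.
    (* Neither the first place nor the one just before [i] may share a block with [i]; the former
       gives [a <= i], the latter [i <= a]. *)
    have := no (Ordinal (leq_ltn_trans (leq0n i) (ltn_ord i))) i_gt0.
    rewrite negb_or /= => ia.
    have lt_i : (i.-1 < n.+1)%N by rewrite (leq_ltn_trans (leq_pred i)).
    by have := no (Ordinal lt_i); rewrite /= negb_or; lia.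
  rewrite /= eq_ia eqxx /=.
  apply/unshuffleP => x y xy ay; apply: sh xy _; move: ay.
  by rewrite /= /bump eq_ia; lia.
have pos z : (lift_perm i ord0 s i < lift_perm i ord0 s (lift i z))%N.
  by rewrite lift_perm_id lift_perm_lift.
case: (unliftP i y) => [y'|] ->; case: (unliftP i x) => [x'|] ->;
    rewrite ?ltnn ?ltn_lift ?lift_ltn ?pos // => xy.
- rewrite !lift_perm_lift ltn_lift.
  case/orP: H => [/andP[/andP[/eqP i0 a_gt0]]|/andP[/eqP ia]] /unshuffleP sP ay;
    by apply: sP xy _; move: ay; rewrite /= /bump ?i0 ?ia; lia.
- case/orP: H => [/andP[/andP[/eqP i0 a_gt0]]|/andP[/eqP ia]]; first by lia.
  by rewrite -ia ltnn [(i <= _)%N]leqNgt lift_ltn xy.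
Qed.

Lemma sum_unshuffle_lift (R : nmodType) n a (F : 'S_n.+1 -> R) (f : nat -> 'S_n -> R) :
  (forall (i : 'I_n.+1) (s : 'S_n), F (lift_perm i ord0 s) = f i s) ->
  \sum_(s | unshuffle a s) F s =
  (if (0 < a)%N then \sum_(s | unshuffle a.-1 s) f 0%N s else 0) +
  (if (a <= n)%N then \sum_(s | unshuffle a s) f a s else 0).
Proof.
move=> Ff; rewrite sum_lift_perm.
have split_i (i : 'I_n.+1) :
    \sum_(s | unshuffle a (lift_perm i ord0 s)) F (lift_perm i ord0 s) =
    (if (i == 0 :> nat) && (0 < a)%N then \sum_(s | unshuffle a.-1 s) f i s else 0) +
    (if i == a :> nat then \sum_(s | unshuffle a s) f i s else 0).
  rewrite (eq_bigl _ _ (unshuffle_lift_perm a i)) (eq_bigr _ (fun s _ => Ff i s)).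
  case: eqP => [i0|_] /=; last by case: eqP => _ /=; rewrite ?big_pred0_eq add0r.
  case: posnP => [a0|a_gt0]; first by rewrite a0 i0 eqxx /= add0r.
  by rewrite i0 (ltn_eqF a_gt0) addr0; under eq_bigl do rewrite orbF.
rewrite (eq_bigr _ (fun i _ => split_i i)) big_split; congr (_ + _).
  by rewrite big_ord_recl /= [X in _ + X]big1 ?addr0.
case: leqP => [le_an|lt_na]; last first.
  by rewrite big1 // => i _; rewrite ltn_eqF // (leq_trans (ltn_ord i)).
by rewrite -big_mkcond (big_pred1 (Ordinal (le_an : a < n.+1)%N)).
Qed.

End Permutations.

(** * Permuted words and their Koszul signs *)

Section PermutedWords.

Variables (k : fieldType) (V : graded k).

Definition remove_tnth (T : Type) n (w : n.+1.-tuple T) (j : 'I_n.+1) : n.-tuple T :=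
  [tuple tnth w (lift j i) | i < n].

Lemma insert_tnth (T : Type) n (w : n.+1.-tuple T) (j : 'I_n.+1) :
  tval w = take j (remove_tnth w j) ++ tnth w j :: drop j (remove_tnth w j).
Proof.
have le_jn : (j <= n)%N by rewrite -ltnS.
apply: (@eq_from_nth _ (tnth w j)) => [|i].
  by rewrite size_cat size_takel ?size_tuple //=; lia.
rewrite size_tuple => lt_in; rewrite nth_cat size_takel ?size_tuple //.
rewrite -[i]/(val (Ordinal lt_in)) -tnth_nth.
have nthE (l : 'I_n) : nth (tnth w j) (remove_tnth w j) l = tnth w (lift j l).
  by rewrite -tnth_nth tnth_mktuple.
case: (unliftP j (Ordinal lt_in)) => [l|] ->; last by rewrite ltnn subnn.
rewrite lift_ltn; case: ltnP => [lj|jl].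
  have -> : \val (lift j l) = l by rewrite /= /bump leqNgt lj.
  by rewrite nth_take ?nthE.
have -> : (\val (lift j l) - j = (l - j).+1)%N by rewrite /= /bump jl add1n subSn.
by rewrite /= nth_drop subnKC ?nthE.
Qed.

Lemma remove_tnthE (T : Type) n (w : n.+1.-tuple T) (j : 'I_n.+1) :
  remove_tnth w j = take j w ++ drop j.+1 w :> seq T.
Proof.
have le_jn : (j <= n)%N by rewrite -ltnS.
rewrite -[LHS](cat_take_drop j) [in RHS](insert_tnth w j).
rewrite take_size_cat ?size_takel ?size_tuple //; congr (_ ++ _).
by rewrite -cat_rcons drop_size_cat // size_rcons size_takel ?size_tuple.
Qed.

Lemma permw_lift_perm (T : Type) n (x : T) (w : n.-tuple T) (i : 'I_n.+1) (s : 'S_n) :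
  permw [tuple of x :: w] (lift_perm i ord0 s) =
  take i (permw w s) ++ x :: drop i (permw w s) :> seq T.
Proof.
set W := permw [tuple of _] _; rewrite (insert_tnth W i).
have -> : tnth W i = x by rewrite tnth_mktuple lift_perm_id.
have -> // : remove_tnth W i = permw w s.
apply: eq_from_tnth => l; rewrite !tnth_mktuple lift_perm_lift.
exact: tnthS.
Qed.

Lemma permw_lift_perm0 (T : Type) n (w : n.+1.-tuple T) (j : 'I_n.+1) (s : 'S_n) :
  permw w (lift_perm ord0 j s) = tnth w j :: permw (remove_tnth w j) s :> seq T.
Proof.
have /(congr1 val) E : [tuple of behead (permw w (lift_perm ord0 j s))] =
    permw (remove_tnth w j) s.
  apply: eq_from_tnth => l; rewrite tnth_behead !tnth_mktuple.
  have -> : inord l.+1 = lift ord0 l by apply: val_inj; rewrite /= inordK ?ltnS.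
  by rewrite lift_perm_lift.
rewrite (tuple_eta (permw w (lift_perm ord0 j s))) /thead tnth_mktuple lift_perm_id.
by congr (_ :: _).
Qed.

Lemma wdeg_take n (w : n.-tuple (homog V)) (j : nat) :
  wdeg (take j w) = \sum_(i < n | (i < j)%N) tag (tnth w i).
Proof.
elim: n w j => [|n IHn] w j.
  by rewrite (tuple0 w) big_ord0 wdeg_nil.
case/tupleP: w => x w; case: j => [|j] /=.
  by rewrite wdeg_nil big_pred0.
rewrite wdeg_cons IHn [RHS]big_mkcond big_ord_recl /= tnth0 big_mkcond.
by congr (_ + _); apply: eq_bigr => i _; rewrite tnthS.
Qed.

Lemma sum_ord_lift (R : nmodType) n (i : 'I_n.+1) (F : 'I_n.+1 -> R) :
  \sum_a F a = F i + \sum_(a < n) F (lift i a).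
Proof. by rewrite (bigD1_ord i). Qed.

(** The first letter [x] is inverted exactly with the letters now standing in front of it. *)
Lemma koszul_lift_perm n (x : homog V) (w : n.-tuple (homog V)) (i : 'I_n.+1)
    (s : 'S_n) :
  koszul [tuple of x :: w] (lift_perm i ord0 s) =
  koszul w s + tag x * wdeg (take i (permw w s)).
Proof.
rewrite /koszul (sum_ord_lift i) big1 ?add0r => [|j]; last first.
  by rewrite lift_perm_id ltn0 andbF.
rewrite wdeg_take mulr_sumr.
rewrite [X in _ + X](big_mkcond (fun a : 'I_n => (a < i)%N)) -big_split.
apply: eq_bigr => a _; rewrite lift_perm_lift tnthS tnth_mktuple.
rewrite [LHS]big_mkcond (sum_ord_lift i) lift_perm_id tnth0 andbT addrC.
congr (_ + _); last by rewrite lift_ltn mulrC.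
rewrite [RHS]big_mkcond; apply: eq_bigr => b _.
by rewrite ltn_lift lift_perm_lift tnthS ltn_lift.
Qed.

(** The letter brought to the front is inverted exactly with those that preceded it in [w]. *)
Lemma koszul_lift_perm0 n (w : n.+1.-tuple (homog V)) (j : 'I_n.+1) (s : 'S_n) :
  koszul w (lift_perm ord0 j s) =
  koszul (remove_tnth w j) s + tag (tnth w j) * wdeg (take j w).
Proof.
rewrite /koszul (sum_ord_lift ord0) lift_perm_id addrC; congr (_ + _).
  apply: eq_bigr => a _.
  rewrite [LHS]big_mkcond (sum_ord_lift ord0) ltn0 add0r [RHS]big_mkcond.
  by apply: eq_bigr => b _; rewrite !lift_perm_lift !tnth_mktuple !ltn_lift.
rewrite wdeg_take big_mkcond (sum_ord_lift ord0) ltnn add0r mulr_sumr.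
rewrite [RHS]big_mkcond (sum_ord_lift j) ltnn add0r [RHS](reindex_inj (@perm_inj _ s)).
by apply: eq_bigr => b _; rewrite lift_perm_lift.
Qed.

End PermutedWords.

(** * Recursive forms of symmetrization, unshuffles and shuffles *)

Section PermutationSums.

Variables (k : fieldType) (V : graded k) (M : lmodType k).

Lemma ins_tuple x (F : word V -> M) n (w : n.-tuple (homog V)) :
  ins x F w = \sum_(i < n.+1) ((-1) ^ (tag x * wdeg (take i w)) : k) *:
    F (take i w ++ x :: drop i w).
Proof. by rewrite insE cut2E size_tuple. Qed.

(** Symmetrizing is shuffling the letters one by one into the empty word: the place of the first
    letter in the permuted word is its place of insertion. *)
Lemma sum_perm_xi n (w : n.-tuple (homog V)) (F : word V -> M) :
  \sum_(s : 'S_n) ((-1) ^ koszul w s : k) *: F (permw w s) = xi w F [::].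
Proof.
elim: n w F => [|n IHn] w F.
  rewrite (tuple0 w) (big_pred1 1%g) => [|s]; last first.
    by apply/esym/eqP/permP => -[].
  by rewrite /koszul big_ord0 scale1r [permw _ _]tuple0.
case/tupleP: w => x w; rewrite sum_lift_perm exchange_big xi_cons -IHn.
apply: eq_bigr => s _; rewrite ins_tuple scaler_sumr.
apply: eq_bigr => i _; rewrite scalerA -signD.
by rewrite koszul_lift_perm permw_lift_perm.
Qed.

(** The first letter heads either the first or the second block, which are the two branches of
    [unsh]. In the first branch the block length [p] drops by one. *)
Lemma sum_unshuffle n (v : n.-tuple (homog V)) (G : word V -> word V -> M) :
  \sum_(p < n.+1) \sum_(s : 'S_n | unshuffle p s)
    ((-1) ^ koszul v s : k) *: G (take p (permw v s)) (drop p (permw v s)) =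
  unsh v G.
Proof.
elim: n v G => [|n IHn] v G.
  rewrite (tuple0 v) big_ord1 (big_pred1 1%g) => [|s]; last first.
    rewrite /= (_ : s = 1%g) ?eqxx; last by apply/permP => -[].
    by apply/unshuffleP => -[].
  by rewrite /koszul big_ord0 scale1r [permw _ _]tuple0.
case/tupleP: v => x v; rewrite -[unsh _ _]/(unsh v _ + unsh v _) -!IHn.
pose f p i (s : 'S_n) : M :=
  ((-1) ^ (koszul v s + tag x * wdeg (take i (permw v s))) : k) *:
  G (take p (take i (permw v s) ++ x :: drop i (permw v s)))
    (drop p (take i (permw v s) ++ x :: drop i (permw v s))).
under eq_bigr => p _.
  rewrite (@sum_unshuffle_lift _ _ _ _ (f p)); last first.
    by move=> i s; rewrite koszul_lift_perm permw_lift_perm.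
  over.
rewrite big_split; congr (_ + _).
  rewrite big_ord_recl; apply: etrans (add0r _) _; apply: eq_bigr => p _; apply: eq_bigr => s _.
  by rewrite /f take0 drop0 wdeg_nil mulr0 addr0.
rewrite big_ord_recr [LHS]/= ltnn addr0.
apply: eq_bigr => p _; rewrite -ltnS ltn_ord.
apply: eq_bigr => s _; rewrite /f signD -scalerA.
by rewrite take_size_cat ?drop_size_cat // size_takel // size_tuple -ltnS.
Qed.

Lemma sum_unshuffle_gt0 n (v : n.-tuple (homog V)) (G : word V -> word V -> M) :
  \sum_(p < n.+1 | (0 < p)%N) \sum_(s : 'S_n | unshuffle p s)
    ((-1) ^ koszul v s : k) *: G (take p (permw v s)) (drop p (permw v s)) =
  unsh v (fun a b => if nilp a then 0 else G a b).
Proof.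
rewrite -sum_unshuffle [LHS]big_mkcond; apply: eq_bigr => p _.
case: posnP => [p0|p_gt0].
  by rewrite big1 // => s _; rewrite p0 take0 scaler0.
have le_pn : (p <= n)%N by rewrite -ltnS.
by apply: eq_bigr => s _; rewrite /nilp size_takel ?size_tuple // (gtn_eqF p_gt0).
Qed.

(* The value of F on the shuffle product of u and v. *)
Fixpoint shuf (u : word V) : word V -> (word V -> M) -> M :=
  fix shuf_u v F :=
    match u, v with
    | [::], _ => F v
    | _, [::] => F u
    | x :: u', y :: v' => shuf u' v (F \o cons x) +
        ((-1) ^ (tag y * wdeg u) : k) *: shuf_u v' (F \o cons y)
    end.

Lemma shuf0 v F : shuf [::] v F = F v.
Proof. by case: v. Qed.

Lemma shuf_nil u F : shuf u [::] F = F u.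
Proof. by case: u. Qed.

Lemma shuf_cons x u y v F :
  shuf (x :: u) (y :: v) F = shuf u (y :: v) (F \o cons x) +
    ((-1) ^ (tag y * wdeg (x :: u)) : k) *: shuf (x :: u) v (F \o cons y).
Proof. by []. Qed.

Lemma eq_shuf u v F G : F =1 G -> shuf u v F = shuf u v G.
Proof.
elim: u v F G => [|x u IHu] v F G eqFG; first by case: v => [|y v]; apply: eqFG.
elim: v F G eqFG => [|y v IHv] F G eqFG; first exact: eqFG.
rewrite !shuf_cons; congr (_ + _ *: _); [apply: IHu | apply: IHv] => w;
  exact: eqFG.
Qed.

Lemma shufP u v F G (a : k) :
  shuf u v (fun w => a *: F w + G w) = a *: shuf u v F + shuf u v G.
Proof.
elim: u v F G => [|x u IHu] v F G; first by case: v.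
elim: v F G => [|y v IHv] F G //.
rewrite !shuf_cons (IHu _ (F \o cons x) (G \o cons x)).
rewrite (IHv (F \o cons y) (G \o cons y)) !scalerDr !scalerA.
by rewrite [_ * a]mulrC addrACA.
Qed.

(* Associativity of the shuffle product, with a single letter on the left. *)
Lemma ins_shuf x u v F :
  ins x (fun u' => shuf u' v F) u = shuf u v (ins x F).
Proof.
elim: u v F => [|y u IHu] v F.
  elim: v F => [|z v IHv] F //.
  rewrite [LHS]shuf_cons; congr (_ + _).
  rewrite wdeg_cons wdeg_nil addr0 mulrC; congr (_ *: _).
  by have := IHv (F \o cons z); rewrite shuf0.
elim: v F => [|z v IHv] F.
  by rewrite shuf_nil; apply: eq_ins => w; rewrite shuf_nil.
have -> : ins x (fun u' => shuf u' (z :: v) F) (y :: u) =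
    shuf (x :: y :: u) (z :: v) F + ((-1) ^ (tag x * tag y) : k) *:
    (ins x (fun u' => shuf u' (z :: v) (F \o cons y)) u +
     ((-1) ^ (tag z * (tag x + wdeg (y :: u))) : k) *:
       ins x (fun u' => shuf (y :: u') v (F \o cons z)) u).
  rewrite -insZ -insD; congr (_ + _ *: _); apply: eq_ins_size => w _ dw.
  by rewrite wdeg_cons addrCA -dw -wdeg_cons.
have E t (G : word V -> M) (w1 w2 : word V) : shuf w1 w2 (ins x G \o cons t) =
    ((-1) ^ (tag x * tag t) : k) *: shuf w1 w2 (ins x (G \o cons t)) +
    shuf w1 w2 (G \o cons x \o cons t).
  by rewrite -shufP; apply: eq_shuf => w /=; rewrite addrC.
rewrite [RHS]shuf_cons !E -IHv -IHu !shuf_cons.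
have -> : ins x (fun u' => shuf u' v (F \o cons z)) (y :: u) =
    shuf (x :: y :: u) v (F \o cons z) + ((-1) ^ (tag x * tag y) : k) *:
    ins x (fun u' => shuf (y :: u') v (F \o cons z)) u by [].
rewrite !scalerDr !scalerA -!signD.
have -> : (-1) ^ (tag x * tag y + tag z * (tag x + wdeg (y :: u))) =
    (-1) ^ (tag z * wdeg (y :: u) + tag x * tag z + tag x * tag y) :> k.
  by congr (_ ^ _); ring.
have -> : (-1) ^ (tag z * wdeg [:: x, y & u]) =
    (-1) ^ (tag z * wdeg (y :: u) + tag x * tag z) :> k.
  by rewrite (wdeg_cons x); congr (_ ^ _); ring.
by rewrite [LHS](AC (3*2) ((4*1)*(3*5*2))).
Qed.

(** A shuffle is the inverse of an unshuffle. After inversion, [unshuffle_lift_perm] says that the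
    shuffled word starts with the head of one of the two factors, as in the recursion of [shuf]. *)
Lemma sum_Sh n a (w : n.-tuple (homog V)) (F : word V -> M) : (a <= n)%N ->
  \sum_(s : 'S_n | unshuffle a s^-1) ((-1) ^ koszul w s : k) *: F (permw w s) =
  shuf (take a w) (drop a w) F.
Proof.
elim: n a w F => [|n IHn] a w F le_an.
  rewrite (tuple0 w) shuf0 (big_pred1 1%g) => [|s]; last first.
    rewrite /= (_ : s = 1%g) ?eqxx; last by apply/permP => -[].
    by apply/unshuffleP => -[].
  by rewrite /koszul big_ord0 scale1r [permw _ _]tuple0.
pose f i (r : 'S_n) : M :=
  let j : 'I_n.+1 := inord i in
  ((-1) ^ (koszul (remove_tnth w j) r^-1 + tag (tnth w j) * wdeg (take j w)) : k) *:
    F (tnth w j :: permw (remove_tnth w j) r^-1).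
have sum_f (j : 'I_n.+1) b : (b <= n)%N -> \sum_(r | unshuffle b r) f j r =
    ((-1) ^ (tag (tnth w j) * wdeg (take j w)) : k) *:
    shuf (take b (remove_tnth w j)) (drop b (remove_tnth w j)) (F \o cons (tnth w j)).
  move=> le_bn; rewrite -IHn // scaler_sumr [LHS](reindex_inj invg_inj).
  by apply: eq_bigr => s _; rewrite /f inord_val invgK addrC signD scalerA.
rewrite (reindex_inj invg_inj).
under eq_bigl do rewrite invgK.
rewrite (sum_unshuffle_lift _ (f := f)) => [|i r]; last first.
  by rewrite lift_permV koszul_lift_perm0 permw_lift_perm0 /f inord_val.
have sum_f0 b : (b <= n)%N -> \sum_(r | unshuffle b r) f 0%N r =
    shuf (take b (behead w)) (drop b (behead w)) (F \o cons (tnth w ord0)).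
  by move=> /(sum_f ord0) ->; rewrite !remove_tnthE take0 wdeg_nil mulr0 scale1r drop1.
have sum_fa : (a <= n)%N -> \sum_(r | unshuffle a r) f a r =
    ((-1) ^ (tag (tnth w (inord a)) * wdeg (take a w)) : k) *:
    shuf (take a w) (drop a.+1 w) (F \o cons (tnth w (inord a))).
  move=> le_an'; have := sum_f (inord a) a le_an'; rewrite inordK // => ->.
  rewrite !remove_tnthE inordK // take_size_cat ?drop_size_cat //;
    by rewrite size_takel // size_tuple.
have w_cons : tval w = tnth w ord0 :: behead w.
  by rewrite {1}(tuple_eta w).
case: a le_an sum_fa => [|a] le_an sum_fa.
  by rewrite add0r sum_f0 // !take0 !drop0 !shuf0 /= -w_cons.
have takeS : take a.+1 w = tnth w ord0 :: take a (behead w) by rewrite {1}w_cons.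
have dropS : drop a (behead w) = drop a.+1 w by rewrite [in RHS]w_cons.
rewrite (ltn0Sn a) sum_f0 // takeS dropS.
case: ltnP => [lt_an|le_na].
  rewrite sum_fa // (drop_nth (tnth w ord0)) ?size_tuple //.
  have -> : nth (tnth w ord0) w a.+1 = tnth w (inord a.+1).
    by rewrite [RHS](tnth_nth (tnth w ord0)) inordK.
  by rewrite shuf_cons takeS.
by rewrite drop_oversize ?size_tuple // !shuf_nil addr0.
Qed.

End PermutationSums.

(** * Graded symmetry from adjacent exchanges *)

Section GradedSymmetry.

Variables (k : fieldType) (V : graded k) (M : lmodType k) (K : word V -> M).

Hypothesis K_swap : forall u v x y,
  K (u ++ x :: y :: v) = ((-1) ^ (tag x * tag y) : k) *: K (u ++ y :: x :: v).

Lemma swap_move u a x v :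
  K (u ++ a ++ x :: v) = ((-1) ^ (tag x * wdeg a) : k) *: K (u ++ x :: a ++ v).
Proof.
elim: a u => [|y a IHa] u; first by rewrite wdeg_nil mulr0 scale1r.
rewrite cat_cons -cat_rcons IHa cat_rcons /= K_swap scalerA -signD wdeg_cons.
by congr (_ ^ _ *: _); ring.
Qed.

Lemma swap_koszul n (w : n.-tuple (homog V)) (s : 'S_n) :
  K w = ((-1) ^ koszul w s : k) *: K (permw w s).
Proof.
(* The prefix [u] collects the letters already brought into place, so that the induction can
   continue behind them. *)
suff Ku u : K (u ++ w) = ((-1) ^ koszul w s : k) *: K (u ++ permw w s).
  exact: (Ku [::]).
elim: n w s u => [|n IHn] w s u.
  by rewrite (tuple0 w) [permw _ _]tuple0 /koszul big_ord0 scale1r.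
have [g _ hK] := lift_perm_bij n; rewrite -(hK s); move: (g s) => [i t] /=.
case/tupleP: w => x w; rewrite koszul_lift_perm permw_lift_perm swap_move scalerA.
rewrite cat_take_drop signD -mulrA sign_sqr mulr1 -!(cat_rcons x).
exact: IHn.
Qed.

End GradedSymmetry.

Section TagPreservingMaps.

Variables (k : fieldType) (V W : graded k) (M : lmodType k).
Variable f : homog V -> homog W.
Hypothesis fE : forall x, tag (f x) = tag x.

Lemma ins_map x (F : word W -> M) w :
  ins (f x) F (map f w) = ins x (F \o map f) w.
Proof. by elim: w F => [|y w IHw] F //=; rewrite !fE IHw. Qed.

Lemma xi_map c (F : word W -> M) w :
  xi (map f c) F (map f w) = xi c (F \o map f) w.
Proof.
elim: c F => [|x c IHc] F //=.
by rewrite IHc; apply: eq_xi => u /=; rewrite ins_map.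
Qed.

Lemma cut2_map w (P : word W -> word W -> M) :
  cut2 (map f w) P = cut2 w (fun u v => P (map f u) (map f v)).
Proof. by elim: w P => //= x w IHw P; rewrite IHw. Qed.

Lemma cut3_map w (P : word W -> word W -> word W -> M) :
  cut3 (map f w) P = cut3 w (fun u m v => P (map f u) (map f m) (map f v)).
Proof. by rewrite /cut3 cut2_map; apply: eq_cut2 => u v _; rewrite cut2_map. Qed.

Lemma unsh_map c (G : word W -> word W -> M) :
  unsh (map f c) G = unsh c (fun a b => G (map f a) (map f b)).
Proof.
elim: c G => //= x c IHc G; rewrite !IHc; congr (_ + _).
by apply: eq_unsh => a b _ _; rewrite fE (wdeg_map _ fE).
Qed.

End TagPreservingMaps.

(** The symmetrization of [c] is obtained by shuffling its letters into the empty word; by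
    associativity ([ins_shuf]) they may be shuffled directly into [o]. *)
Lemma apply_op_Xi (k : fieldType) (C O W : graded k) (D : op (gsum C O) W)
    (c : word C) (o : word O) (e : int) :
  apply_op D (Xi c o) e =
  xi (map (@inC k C O) c) (D^~ e) (map (@inO k C O) o).
Proof.
set o' := map _ o.
have ShE u : \sum_(t <- Sh u o') t.1 *: D t.2 e = shuf u o' (D^~ e).
  rewrite /Sh big_map big_filter big_enum_cond.
  apply: etrans (sum_Sh (in_tuple (u ++ o')) (D^~ e) _) _.
    by rewrite size_cat leq_addr.
  by rewrite take_size_cat ?drop_size_cat.
rewrite /apply_op /Xi big_flatten big_map /chi big_map big_enum.
under eq_bigr => s _.
  rewrite big_map /=.
  under eq_bigr => t _ do rewrite /= -scalerA.
  rewrite -scaler_sumr ShE.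
  over.
rewrite (sum_perm_xi (in_tuple c) (fun w => shuf (map (@inC k C O) w) o' (D^~ e))).
have -> : xi c (fun w => shuf (map (@inC k C O) w) o' (D^~ e)) [::] =
    xi (map (@inC k C O) c) (fun w => shuf w o' (D^~ e)) [::].
  by rewrite -[X in xi (map _ _) _ X]/(map (@inC k C O) [::]) xi_map.
elim: {c} (map _ c) (D^~ e) => [|x c IHc] F; first exact: shuf0.
by rewrite !xi_cons -IHc; apply: eq_xi => u; rewrite ins_shuf.
Qed.

(** * The OCHA of an extension *)

Section LinearImages.

Variables (k : fieldType) (V : graded k) (M N : lmodType k) (f : M -> N).
Hypothesis f_lin : linear f.

Lemma linear_imageDZ (a : k) x y : f (x + a *: y) = f x + a *: f y.
Proof. by rewrite addrC f_lin addrC. Qed.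

Lemma linear_image0 : f 0 = 0.
Proof. by have := f_lin (-1) 0 0; rewrite scaler0 addr0 scaleN1r addNr. Qed.

Lemma linear_imageZ (a : k) x : f (a *: x) = a *: f x.
Proof. by rewrite -[a *: x]addr0 f_lin linear_image0 addr0. Qed.

Lemma ins_image x (F : word V -> M) w : f (ins x F w) = ins x (f \o F) w.
Proof. by elim: w F => [|y w IHw] F //=; rewrite linear_imageDZ IHw. Qed.

Lemma xi_image c (F : word V -> M) w : f (xi c F w) = xi c (f \o F) w.
Proof.
elim: c F => [|x c IHc] F //.
by rewrite !xi_cons IHc; apply: eq_xi => u; apply: ins_image.
Qed.

Lemma unsh_image c (G : word V -> word V -> M) :
  f (unsh c G) = unsh c (fun u v => f (G u v)).
Proof.
elim: c G => [|x c IHc] G //=.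
rewrite -[unsh c (fun a b => _ *: _)]scale1r linear_imageDZ scale1r !IHc.
by congr (_ + _); apply: eq_unsh => u v _ _; apply: linear_imageZ.
Qed.

Lemma cut2_image w (P : word V -> word V -> M) :
  f (cut2 w P) = cut2 w (fun u v => f (P u v)).
Proof.
elim: w P => [|x w IHw] P //=.
by rewrite -[cut2 w _ in LHS]scale1r linear_imageDZ scale1r IHw.
Qed.

Lemma cut3_image w (P : word V -> word V -> word V -> M) :
  f (cut3 w P) = cut3 w (fun u m v => f (P u m v)).
Proof. by rewrite /cut3 cut2_image; apply: eq_cut2 => u v _; rewrite cut2_image. Qed.

End LinearImages.

Section Vanishing.

Variables (k : fieldType) (V : graded k) (M : lmodType k) (x : homog V).

(** Inserting a letter never removes [x]. It serves to propagate the ideal property of the open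
    summand through shuffles. *)
Lemma ins_vanish y (F : word V -> M) :
  (forall u v, F (u ++ x :: v) = 0) -> forall u v, ins y F (u ++ x :: v) = 0.
Proof.
move=> F0 u v; rewrite ins_cat.
rewrite (@eq_ins _ _ _ y _ (fun=> 0) (F0^~ v)) (@eq_ins _ _ _ y _ (fun=> 0) (F0 u)) !ins0.
by rewrite scaler0 addr0.
Qed.

Lemma xi_vanish c (F : word V -> M) :
  (forall u v, F (u ++ x :: v) = 0) -> forall u v, xi c F (u ++ x :: v) = 0.
Proof. by elim: c F => [|y c IHc] F F0 //; apply/IHc/ins_vanish. Qed.

Lemma cut3_nil w (P : word V -> word V -> word V -> M) :
  (forall u m v, m != [::] -> P u m v = 0) ->
  cut3 w P = cut2 w (fun u v => P u [::] v).
Proof.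
move=> P0; apply: eq_cut2 => u r _; case: r => [|y r] //=.
by rewrite (@eq_cut2 _ _ _ _ _ (fun _ _ => 0)) ?cut2_0 ?addr0 // => m v _; apply: P0.
Qed.

Lemma xi_tagged c (d : int) (G : word V -> V d) (F : word V -> M) u v w :
  multilin F ->
  F (u ++ Tagged V (xi c G w) :: v) =
  xi c (fun m => F (u ++ Tagged V (G m) :: v)) w.
Proof. by move=> Flin; rewrite (xi_image (Flin u v d)). Qed.

Lemma multilin0 (F : word V -> M) u v (d : int) :
  multilin F -> F (u ++ Tagged V (0 : V d) :: v) = 0.
Proof.
move=> Flin; have := Flin u v d (-1) 0 0.
by rewrite scaler0 addr0 scaleN1r addNr.
Qed.

End Vanishing.

(** * The relations on a direct sum with an open ideal *)

Section DirectSum.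

Variables (k : fieldType) (C O : graded k).
Local Notation V := (gsum C O).
Local Notation mapC := (map (@inC k C O)).
Local Notation mapO := (map (@inO k C O)).

Definition fstH : homog V -> homog C := hmap (fun d (x : V d) => x.1).

Variables (D : op V V) (mC : op C C).
Hypotheses (D_Ainfty : is_Ainfty D) (mC_multilinear : multilinear mC).
Hypothesis D_fst : forall w e, w != [::] -> (D w e).1 = mC (map fstH w) e.

Lemma fst_linear (M N : lmodType k) : linear (@fst M N).
Proof. by []. Qed.

Lemma snd_linear (M N : lmodType k) : linear (@snd M N).
Proof. by []. Qed.

Lemma D_multilin e : multilin (D^~ e).
Proof. by move=> u v d; apply: (Ainfty_multilinear D_Ainfty). Qed.

Lemma Xi_lE c e : Xi_l D c e = (xi (mapC c) (D^~ e) [::]).1.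
Proof. by rewrite /Xi_l apply_op_Xi. Qed.

Lemma Xi_nE c o e : Xi_n D c o e = (xi (mapC c) (D^~ e) (mapO o)).2.
Proof. by rewrite /Xi_n apply_op_Xi. Qed.

(* D is extended by zero to the empty word, on which its value is junk. *)
Definition D0 : op V V := fun w e => if w is [::] then 0 else D w e.

(** The open summand is an ideal: the closed component of [D] factors through the projection, which
    kills the letter [x]. *)
Lemma D_fst_inO e x u v : (D (u ++ @inO k C O x :: v) e).1 = 0.
Proof.
rewrite D_fst; last by case: u.
by rewrite map_cat /=; apply: (multilin0 (F := mC^~ e)) => u' v' d; apply: mC_multilinear.
Qed.

Lemma xi_D0 c w e : (0 < size c + size w)%N -> xi c (D0^~ e) w = xi c (D^~ e) w.
Proof. by move=> cw_gt0; apply: eq_xi_size => -[|x u] su _ //; rewrite -su in cw_gt0. Qed.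

(** The coderivation [cod] also cuts out empty factors, absent from the $A_\infty$ relation; these
    contribute zero because [D0] does on the empty word. *)
Lemma cod_D0 w e : w != [::] -> cod D0 [::] (D^~ e) w = 0.
Proof.
move=> w_neq0; rewrite -[RHS](Ainfty_rel D_Ainfty e w_neq0) /cod cut3E.
apply: eq_bigr => i _; rewrite [LHS]big_mkcond [RHS]big_mkcond.
apply: eq_bigr => s _; rewrite wdeg_nil addr0 mul1r.
case le_is: (i + s <= size w)%N; last by rewrite andbF.
rewrite andbT; case: (posnP s) => [->|s_gt0].
  rewrite take0 [X in _ *: X](_ : _ = 0) ?scaler0 //.
  exact: (multilin0 _ _ _ (@D_multilin e)).
congr (_ *: D (_ ++ _ :: _) e).
have : take s (drop i w) != [::] by rewrite -size_eq0 size_takel ?size_drop; lia.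
by rewrite /hval; case: take.
Qed.

Lemma xi_cod_D0 c w e : (0 < size c + size w)%N -> xi c (cod D0 [::] (D^~ e)) w = 0.
Proof.
move=> cw_gt0; rewrite -[RHS](xi0 _ c w); apply: eq_xi_size => u su _.
by apply: cod_D0; rewrite -size_eq0 su -lt0n.
Qed.

(** The inner value splits into its two components. The closed one vanishes as soon as [m] has a
    letter, by the ideal property. *)
Lemma xi_hval_D0 (M : lmodType k) c m (F : word V -> M) u v : multilin F ->
  xi (mapC c) (fun m' => F (u ++ hval D0 m' :: v)) (mapO m) =
  (if nilp c && nilp m then 0 else F (u ++ @inO k C O (hval2 (Xi_n D) c m) :: v)) +
  (if ~~ nilp c && nilp m then F (u ++ @inC k C O (hval (Xi_l D) c) :: v) else 0).
Proof.
move=> Flin; pose d := 1 + (wdeg c + wdeg m).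
(* All words in the shuffle have the same degree, so their values lie in the single component [d],
   and multilinearity of [F] gathers them in one slot. *)
have -> : xi (mapC c) (fun m' => F (u ++ hval D0 m' :: v)) (mapO m) =
    F (u ++ Tagged V (xi (mapC c) (D0^~ d) (mapO m)) :: v).
  rewrite xi_tagged //; apply: eq_xi_size => m' _.
  by rewrite !wdeg_map // /hval => ->.
have [cm0|cm_gt0] := posnP (size c + size m).
  move: cm0; case: c @d => [|x c] // d; case: m @d => [|y m] // d _ /=.
  by rewrite addr0; apply: multilin0.
rewrite xi_D0 ?size_map //; set z := xi _ _ _.
have -> : nilp c && nilp m = false by rewrite /nilp; lia.
have -> : @inO k C O (hval2 (Xi_n D) c m) = Tagged V ((0, z.2) : V d).
  by rewrite /hval2 Xi_nE.
have -> : Tagged V z = Tagged V (1 *: ((0, z.2) : V d) + ((z.1, 0) : V d)).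
  by rewrite scale1r; congr (Tagged V _); case: (z) => z1 z2; congr (_, _);
    rewrite /= ?add0r ?addr0.
rewrite Flin scale1r; congr (_ + _).
case: m cm_gt0 @d @z => [|x m] cm_gt0 d z; last first.
  rewrite andbF /z (xi_image (@fst_linear _ _)).
  have := @xi_vanish k V _ (@inO k C O x) (mapC c) (fst \o D^~ d) _ [::] (mapO m).
  move=> /= ->; last by move=> u' v'; apply: D_fst_inO.
  exact: multilin0.
case: c cm_gt0 @d @z => // x c _ d z /=.
by rewrite /hval -[1 + wdeg _](_ : d = _) ?Xi_lE // /d wdeg_nil addr0.
Qed.

(** This is the vanishing of $\mathcal D\hat{\mathcal D}\,\Xi(c;o)$ before projection; its two
    components yield the $L_\infty$ and OCHA relations. *)
Lemma unsh_Xi_relation c o e : (0 < size c + size o)%N ->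
  unsh c (fun c1 c2 => if nilp c1 then 0 else
    xi (mapC (hval (Xi_l D) c1 :: c2)) (D^~ e) (mapO o)) +
  unsh c (fun c1 c2 => ((-1) ^ wdeg c1 : k) *:
    cut3 o (fun a1 a2 a3 => ((-1) ^ (wdeg a1 + wdeg a1 * wdeg c2) : k) *:
      if nilp c2 && nilp a2 then 0 else
      xi (mapC c1) (D^~ e) (mapO (a1 ++ hval2 (Xi_n D) c2 a2 :: a3)))) = 0.
Proof.
move=> co_gt0; rewrite -[RHS](@xi_cod_D0 (mapC c) (mapO o) e) ?size_map //.
(* In [xi_cod] the absorbed letters form the second word, whereas the terms with an inner [l] list
   them first; hence the exchange. *)
rewrite xi_cod unsh_map // unsh_swap -unshD; apply: eq_unsh => c1 c2 _ _.
set H := xi (mapC c1) (D^~ e).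
have Hlin : multilin H by apply/xi_multilin/D_multilin.
rewrite /cod cut3_map !wdeg_map // wdeg_nil addr0 mul1r cat0s.
under [in RHS]eq_cut3 => a1 a2 a3 _.
  rewrite xi_hval_D0 // !wdeg_map // scalerDr.
  over.
rewrite cut3D scalerDr addrC; congr (_ + _).
  congr (_ *: _); apply: eq_cut3 => a1 a2 a3 _; rewrite map_cat.
  by congr (_ ^ _ *: _); ring.
rewrite cut3_nil; last by move=> u [] // x m v _; rewrite andbF scaler0.
case: (nilp c2); first by under eq_cut2 do rewrite scaler0; rewrite cut2_0 !scaler0.
set z := @inC k C O _.
(* An inner value without open inputs may sit anywhere in [o]; the sum over its positions is the
   shuffle with the letter [z], which then moves to the front of [c1]. *)
have -> : cut2 o (fun u v => ((-1) ^ ((1 + wdeg c2) * wdeg u) : k) *: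
    H (mapO u ++ z :: mapO v)) = ins z H (mapO o).
  by rewrite insE cut2_map; apply: eq_cut2 => u v _; rewrite wdeg_map.
rewrite -xi_rcons xi_move scalerA -signD wdeg_map //=.
by congr (_ *: _); apply: (sign_eq (- wdeg c1)); ring.
Qed.

Lemma Xi_l_multilinear : multilinear (Xi_l D).
Proof.
move=> u v d e a x y; rewrite !Xi_lE !map_cat /=.
have -> : @inC k C O (Tagged C (a *: x + y)) =
    Tagged V (a *: ((x, 0) : V d) + ((y, 0) : V d)).
  by congr (Tagged V _); congr (_, _); rewrite /= scaler0 addr0.
by rewrite (xi_linear _ _ _ (@D_multilin e)).
Qed.

Lemma Xi_n_multilinear_C o : multilinear (fun v => Xi_n D v o).
Proof.
move=> u v d e a x y; rewrite !Xi_nE !map_cat /=.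
have -> : @inC k C O (Tagged C (a *: x + y)) =
    Tagged V (a *: ((x, 0) : V d) + ((y, 0) : V d)).
  by congr (Tagged V _); congr (_, _); rewrite /= scaler0 addr0.
by rewrite (xi_linear _ _ _ (@D_multilin e)).
Qed.

Lemma Xi_n_multilinear_O c : multilinear (Xi_n D c).
Proof.
move=> u v d e a x y; rewrite !Xi_nE !map_cat /=.
have -> : @inO k C O (Tagged O (a *: x + y)) =
    Tagged V (a *: ((0, x) : V d) + ((0, y) : V d)).
  by congr (Tagged V _); congr (_, _); rewrite /= scaler0 addr0.
by rewrite (xi_multilin (mapC c) (@D_multilin e)).
Qed.

Lemma xi_D_degree c o e : (0 < size c + size o)%N -> e != 1 + (wdeg c + wdeg o) ->
  xi (mapC c) (D^~ e) (mapO o) = 0.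
Proof.
move=> co_gt0 e_neq; rewrite -[RHS](xi0 _ (mapC c) (mapO o)).
apply: eq_xi_size => u; rewrite !size_map !wdeg_map // => su du.
by apply: (Ainfty_degree D_Ainfty); rewrite ?du // -size_eq0 su -lt0n.
Qed.

Lemma Xi_symmetric o n (w : n.-tuple (homog C)) (s : 'S_n) e :
  xi (mapC w) (D^~ e) (mapO o) =
  ((-1) ^ koszul w s : k) *: xi (mapC (permw w s)) (D^~ e) (mapO o).
Proof.
apply: (swap_koszul (K := fun v => xi (mapC v) (D^~ e) (mapO o))) => u v x y.
by rewrite !map_cat /= xi_swap.
Qed.

(** Take no open inputs and project to the closed summand: terms with an open inner value die by the
    ideal property. *)
Lemma Xi_Linfty_relation : Linfty_relation (Xi_l D).
Proof.
move=> n v e n_gt0.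
rewrite (sum_unshuffle_gt0 v (fun a b => Xi_l D (hval (Xi_l D) a :: b) e)).
have := congr1 fst (@unsh_Xi_relation v [::] e _).
rewrite size_tuple addn0 => /(_ n_gt0); rewrite -unshD.
rewrite (unsh_image (@fst_linear _ _)); apply: etrans; apply: eq_unsh => c1 c2 _ _.
rewrite /cut3 /= wdeg_nil mul0r addr0 scale1r.
rewrite [X in _ + _ *: X](_ : _ = 0) ?scaler0 ?addr0.
  by rewrite Xi_lE; case: ifP.
case: ifP => // _; rewrite (xi_image (@fst_linear _ _)).
by apply: (@xi_vanish _ _ _ _ _ _ _ [::]) => u v'; apply: D_fst_inO.
Qed.

Lemma Xi_Linfty : is_Linfty (Xi_l D).
Proof.
split; first exact: Xi_l_multilinear.
- move=> w e w_neq0 e_neq; rewrite Xi_lE (@xi_D_degree w [::]) //.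
    by rewrite addn0 lt0n size_eq0.
  by rewrite wdeg_nil addr0.
- by move=> n w s e; rewrite !Xi_lE (Xi_symmetric [::] w s).
exact: Xi_Linfty_relation.
Qed.

Lemma Xi_OCHA_relation : OCHA_relation (Xi_l D) (Xi_n D).
Proof.
move=> n m v a e nm_gt0.
rewrite (sum_unshuffle_gt0 v (fun c1 c2 => Xi_n D (hval (Xi_l D) c1 :: c2) a e)).
have := congr1 snd (@unsh_Xi_relation v a e _).
rewrite !size_tuple => /(_ nm_gt0) Exi.
rewrite -[RHS]Exi [RHS]/=.
rewrite !(unsh_image (@snd_linear _ _)); congr (_ + _).
  by apply: eq_unsh => c1 c2 _ _; rewrite Xi_nE; case: ifP.
rewrite -sum_unshuffle; apply: eq_bigr => p _; apply: eq_bigr => s _.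
rewrite (linear_imageZ (@snd_linear _ _)) (cut3_image (@snd_linear _ _)) cut3E.
rewrite size_tuple !scaler_sumr; apply: eq_bigr => i _.
rewrite !scaler_sumr [LHS]big_mkcond [RHS]big_mkcond; apply: eq_bigr => t _.
case le_it: (i + t <= m)%N; rewrite ?andFb // andTb.
rewrite (linear_imageZ (@snd_linear _ _)).
(* The range [r + s >= 1] of the OCHA relation is the condition that the inner operation has an
   input. *)
have -> : (0 < n - p + t)%N =
    ~~ (nilp (drop p (permw v s)) && nilp (take t (drop i a))).
  rewrite /nilp size_drop size_takel ?size_drop ?size_tuple; last by lia.
  by rewrite -addn_eq0 lt0n.
case: (_ && _); first by rewrite !scaler0.
by rewrite !scalerA -Xi_nE -!signD !addrA.
Qed.

Lemma Xi_OCHA : is_OCHA (Xi_l D) (Xi_n D).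
Proof.
split.
- exact: Xi_Linfty.
- exact: Xi_n_multilinear_C.
- exact: Xi_n_multilinear_O.
- by move=> v a e va_gt0 e_neq; rewrite Xi_nE xi_D_degree.
- by move=> a n w s e; rewrite !Xi_nE (Xi_symmetric a w s).
- exact: Xi_OCHA_relation.
Qed.

End DirectSum.

(** * Transport along the splitting *)

Section SplitStructure.

Variables (k : fieldType) (A E B : graded k).
Variables (iota : gmap A E) (p : gmap E B) (s : gmap B E).
Hypotheses (ex : short_exact iota p) (sK : forall d, cancel (s d) (p d)).

Local Notation iso := (@split_iso k A E B iota s).
Local Notation inv := (split_inv ex sK).

Lemma split_iso_linear d : linear (@iso d).
Proof.
move=> a x y; rewrite /split_iso /= !linearP scalerDr.
by rewrite addrACA.
Qed.

Lemma split_inv_linear d : linear (@split_inv k A E B iota p s ex sK d).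
Proof.
move=> a x y; apply: (can_inj (@split_isoK _ _ _ _ _ _ _ ex sK d)).
by rewrite split_iso_linear !split_invK.
Qed.

Lemma p_split_iso d x : p d (@iso d x) = x.1.
Proof.
rewrite /split_iso linearD /= sK.
by rewrite (_ : p d (iota d x.2) = 0) ?add0r //; apply/(short_exact_mid ex); exists x.2.
Qed.

Variable D : op E E.
Hypothesis D_Ainfty : is_Ainfty D.
Local Notation D' := (split_op ex sK D).

Lemma split_op_Ainfty : is_Ainfty D'.
Proof.
split.
- move=> u v d e a x y; rewrite /split_op !map_cat /=.
  rewrite /hmap /= split_iso_linear -/(hmap _).
  by rewrite (Ainfty_multilinear D_Ainfty) split_inv_linear.
- move=> w e w_neq0 e_neq; rewrite /split_op (Ainfty_degree D_Ainfty).
  + by apply: (linear_image0 (@split_inv_linear e)).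
  + by case: w w_neq0 {e_neq}.
  + by rewrite wdeg_map.
move=> w e w_neq0; rewrite -[RHS](linear_image0 (@split_inv_linear e)).
have <- := Ainfty_rel D_Ainfty e (w := map (hmap iso) w) _; last by case: w w_neq0.
have invD : {morph @split_inv k A E B iota p s ex sK e : x y / x + y}.
  by move=> x y; rewrite -[y]scale1r (linear_imageDZ (@split_inv_linear e)) !scale1r.
rewrite size_map (big_morph _ invD (linear_image0 (@split_inv_linear e))).
apply: eq_bigr => i _; rewrite (big_morph _ invD (linear_image0 (@split_inv_linear e))).
apply: eq_bigr => t _; rewrite (linear_imageZ (@split_inv_linear e)).
rewrite -map_take wdeg_map // /split_op map_cat /= -!map_drop -map_take.
congr (_ *: inv (D (_ ++ _ :: _) e)).
by rewrite /hmap /hval /split_op /= split_invK !wdeg_map.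
Qed.

(** Under the splitting [p] becomes the first projection, so its being a strict morphism is the
    hypothesis required of the direct sum. *)
Lemma split_op_fst (mB : op B B) : linear_Ainfty_morphism D mB p ->
  forall w e, w != [::] -> (D' w e).1 = mB (map (@fstH k B A) w) e.
Proof.
move=> Dp w e w_neq0; rewrite -p_split_iso split_invK Dp; last by case: w w_neq0.
rewrite -map_comp; congr (mB _ e); apply: eq_map => x.
by rewrite /= /fstH /hmap /= p_split_iso.
Qed.

End SplitStructure.

(** On closed letters the first component of [D] is [mC], and with no open letter [Xi] reduces to
    the symmetrization. *)
Lemma Xi_l_Lada_Markl (k : fieldType) (C O : graded k)
    (D : op (gsum C O) (gsum C O)) (mC : op C C) :
  (forall w e, w != [::] -> (D w e).1 = mC (map (@fstH k C O) w) e) ->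
  forall w e, w != [::] -> Xi_l D w e = Lada_Markl mC w e.
Proof.
move=> D_fst w e w_neq0; rewrite /Lada_Markl (sum_perm_xi (in_tuple w) (mC^~ e)).
rewrite Xi_lE (xi_image (@fst_linear _ _ _)) -[X in xi _ _ X]/(map (@inC k C O) [::]).
rewrite xi_map //; apply: eq_xi_size => u su _.
rewrite /= D_fst.
  by rewrite -map_comp; congr (mC _ e); rewrite -[RHS]map_id; apply: eq_map => -[].
by rewrite -size_eq0 size_map su addn0 size_eq0.
Qed.

Theorem theorem2 (k : fieldType) (char0 : [pchar k] =i pred0)
    (A B E : graded k) (mA : op A A) (mB : op B B) (D : op E E)
    (hA : is_Ainfty mA) (hB : is_Ainfty mB)
    (iota : gmap A E) (p : gmap E B)
    (hE : is_Ainfty_extension mA D mB iota p)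
    (s : gmap B E) (sK : forall d : int, cancel (s d) (p d)) :
  let D' := split_op (extension_exact hE) sK D in
  is_OCHA (Xi_l D') (Xi_n D') /\
  (forall (w : word B) (e : int), w != [::] ->
     Xi_l D' w e = Lada_Markl mB w e).
Proof.
have D_fst := split_op_fst (extension_exact hE) sK (extension_p hE).
split; last exact: Xi_l_Lada_Markl.
apply: (Xi_OCHA _ (Ainfty_multilinear hB) D_fst).
exact: split_op_Ainfty (extension_Ainfty hE).
Qed.
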